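(* Let $(X,\cdot)$ be a rack and let $B:X\to X$ be an averaging operator on $X$. Define a binary operation on $X$ by $$x\circ_B y:=x\cdot B(y),\qquad x,y\in X.$$ Then: (i) $(X,\circ_B)$ is a rack; moreover, if $x\cdot B(x)=x$ for all $x\in X$, then $(X,\circ_B)$ is a quandle; (ii) $B$ is an averaging operator on the rack $(X,\circ_B)$; (iii) the map $B:(X,\circ_B)\to(X,\cdot)$ is a homomorphism.
   Context: A groupoid is a non-empty set with a binary operation. A rack is a groupoid $(Q,* )$ such that (Q2) for all $x,y\in Q$ there is a unique $z\in Q$ with $x=z*y$, and (Q3) $(x*y)*z=(x*z)*(y*z)$ for all $x,y,z\in Q$. A quandle is a rack satisfying also (Q1) $x*x=x$ for all $x\in Q$. An averaging operator (meaning: right averaging operator) on a rack $(X,\cdot)$ is a map $B:X\to X$ such that $B(x)\cdot B(y)=B(x\cdot B(y))$ for all $x,y\in X$. A homomorphism of racks is a map preserving the operations. *)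

(* Defs.v *)
From mathcomp Require Import all_boot.

Set Implicit Arguments.
Unset Strict Implicit.
Unset Printing Implicit Defensive.

(* (Q2) says that right translations are bijective and (Q3) is right
   self-distributivity, which ssrfun calls [left_distributive op op]:
   (x * y) * z = (x * z) * (y * z).  Groupoids (magmas) are nonempty. *)
Record is_rack (X : Type) (op : X -> X -> X) : Prop := IsRack {
  rack_nonempty : inhabited X;
  rack_div : forall x y : X, exists! z : X, x = op z y;
  rack_dist : left_distributive op op
}.

Record is_quandle (X : Type) (op : X -> X -> X) : Prop := IsQuandle {
  quandle_rack : is_rack op;
  quandle_idem : forall x : X, op x x = x
}.

(* Right averaging operators. *)
Definition averaging_operator (X : Type) (op : X -> X -> X) (B : X -> X) : Prop :=
  forall x y : X, op (B x) (B y) = B (op x (B y)).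

Definition rack_hom (X Y : Type) (opX : X -> X -> X) (opY : Y -> Y -> Y)
    (f : X -> Y) : Prop :=
  {morph f : x y / opX x y >-> opY x y}.

Definition averaged_op (X : Type) (op : X -> X -> X) (B : X -> X) : X -> X -> X :=
  fun x y => op x (B y).

(* Main.v *)
Require Import Defs.
From mathcomp Require Import all_boot.

(** Right translation by [y] for the new operation is right translation by
    [B y] for the old one, hence bijective. The averaging identity is exactly
    what turns self-distributivity of [op] at [x], [B y], [B z] into
    self-distributivity of the new operation, since it rewrites
    [op (B y) (B z)] as [B] applied to the new product of [y] and [z]. *)
Lemma averaged_op_rack (X : Type) (op : X -> X -> X) (B : X -> X) :
  is_rack op -> averaging_operator op B -> is_rack (averaged_op op B).
Proof.
case=> X_inh op_div op_dist hB; split=> [//|x y|x y z].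
- exact: op_div x (B y).
- by rewrite /averaged_op op_dist hB.
Qed.

Theorem theorem4p7 (X : Type) (op : X -> X -> X) (B : X -> X)
    (hX : is_rack op) (hB : averaging_operator op B) :
  (is_rack (averaged_op op B) /\
   ((forall x : X, op x (B x) = x) -> is_quandle (averaged_op op B))) /\
  averaging_operator (averaged_op op B) B /\
  rack_hom (averaged_op op B) op B.
Proof.
have hR := averaged_op_rack _ _ _ hX hB.
split; first by split=> // idem; split.
split=> x y.
- (* The averaging identity of the old operation, with [B y] in place of [y]. *)
  exact: hB x (B y).
- by rewrite /averaged_op hB.
Qed.
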